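(* Let $\lambda_1,\lambda_2,\mu_1,\mu_2>0$ and $\theta_s>0$. Consider the one-sided N-system matching queue with reneging, described by the continuous-time Markov chain on $\mathbb{Z}_{\ge 0}^2$ with the transition rates given in the context, and let $\pi_{m,n}$ denote the steady state (stationary) probability of state $(m,n)$. Then the steady state probabilities are given by $$ \pi_{m,n}=\begin{cases} \left(\dfrac{\mu_1}{\mu_1+\mu_2+m\theta_s}\right)\left(\displaystyle\prod_{i=1}^m\frac{\lambda_2}{\mu_2+i\theta_s}\right)\left(\displaystyle\prod_{i=1}^n\frac{\lambda_1+\lambda_2}{\mu_1+\mu_2+m\theta_s+i\theta_s}\right)B, & m\ge 1,\ n\ge 0,\\[2ex] \left(\displaystyle\prod_{i=1}^n\frac{\lambda_1+\lambda_2}{\mu_1+\mu_2+i\theta_s}\right)B, & m=0,\ n\ge 0, \end{cases} $$ where $B$ is a normalizing constant equal to $\pi_{0,0}$, the steady state probability of the system being empty.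
   Context: **The one-sided N-system with reneging.** Flexible supply (type 1) and inflexible supply (type 2) arrive as independent Poisson processes with rates $\lambda_1$ and $\lambda_2$; type 1 and type 2 demand arrive as independent Poisson processes with rates $\mu_1$ and $\mu_2$. Flexible supply can be matched to type 1 or type 2 demand; inflexible supply can be matched only to type 2 demand. Matching is first-come first-served (FCFS): an arriving demand unit is matched to the earliest-arrived compatible supply unit waiting; if there is none, the demand unit leaves immediately (demand does not queue). Supply units queue until matched, and each waiting supply unit abandons (reneges) after an independent exponential time of rate $\theta_s$. Put $\gamma_s=\lambda_1/(\lambda_1+\lambda_2)$, the probability that an arriving supply unit is flexible. **State representation.** The waiting supply units, arranged in order of arrival, are split into a ''known'' part at the head of the queue, consisting of $m$ units known to be inflexible, and an ''unknown'' part at the tail, consisting of $n$ units whose types have not been revealed (independently, each is flexible with probability $\gamma_s$). The state is $(m,n)$ with $m,n\in\mathbb{Z}_{\ge0}$. An arriving type 2 demand takes the unit at the head of the queue, if any. An arriving type 1 demand scans the unknown units in order of arrival until it finds a flexible one, which it takes; the scanned inflexible units join the known part. If no flexible unit is found, the demand leaves and all $n$ unknown units join the known part. **Transition rates of the resulting continuous-time Markov chain** (rates to the same target state are added): - $(m,n)\to(m,n+1)$ at rate $\lambda_1+\lambda_2$, for all $m,n\ge0$; - $(m,n)\to(m-1,n)$ at rate $\mu_2+m\theta_s$, for $m\ge1$, $n\ge0$; - $(0,n)\to(0,n-1)$ at rate $\mu_2$, for $n\ge1$; - $(m,n)\to(m,n-1)$ at rate $n\theta_s$, for $m\ge0$,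 $n\ge1$; - $(m,n)\to(m+k,n-k-1)$ at rate $\mu_1\gamma_s(1-\gamma_s)^k$, for $m\ge0$, $n\ge1$, $0\le k\le n-1$; - $(m,n)\to(m+n,0)$ at rate $\mu_1(1-\gamma_s)^n$, for $m\ge0$, $n\ge1$. The steady state probabilities $(\pi_{m,n})$ are the probability distribution on $\mathbb{Z}_{\ge0}^2$ satisfying the global balance (equilibrium) equations of this chain. Empty products equal $1$. *)

(* Defs.v *)
From HB Require Import structures.
From mathcomp Require Import all_boot all_order all_algebra.
From mathcomp Require Import all_classical all_reals all_analysis.

Set Implicit Arguments.
Unset Strict Implicit.
Unset Printing Implicit Defensive.

Import Order.TTheory GRing.Theory Num.Theory.
Local Open Scope classical_set_scope.
Local Open Scope ring_scope.

(* [q s t] is the transition rate from s to t. Global balance is stated as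
   total flow out of s = total flow into s. Infinitely many states may lead
   into s, hence the sums in \bar R; a self-rate q s s, if any,
   would appear on both sides. *)
Definition steady_state (R : realType) (S : choiceType) (q : S -> S -> R)
    (pi : S -> R) : Prop :=
  [/\ forall s, 0 <= pi s,
      \esum_(s in [set: S]) (pi s)%:E = 1%E &
      forall s, \esum_(t in [set: S]) (pi s * q s t)%:E =
                \esum_(t in [set: S]) (pi t * q t s)%:E].

Definition flexible_prob (R : realType) (lambda1 lambda2 : R) : R :=
  lambda1 / (lambda1 + lambda2).

(* A state is a pair (m, n): m waiting units known to be inflexible, followed
   by n waiting units of unrevealed type. [b%:R] with b : bool is the indicator
   of b; contributions with the same target are added. *)
Definition N_rate (R : realType) (lambda1 lambda2 mu1 mu2 theta : R)
    (s t : nat * nat) : R :=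
  let gamma := flexible_prob lambda1 lambda2 in
  let: (m, n) := s in
    (lambda1 + lambda2) * (t == (m, n.+1))%:R
  + (mu2 + m%:R * theta) * ((0 < m)%N && (t == (m.-1, n)))%:R
  + mu2 * [&& m == 0%N, (0 < n)%N & t == (0%N, n.-1)]%:R
  + (n%:R * theta) * ((0 < n)%N && (t == (m, n.-1)))%:R
  + \sum_(0 <= k < n)
      mu1 * gamma * (1 - gamma) ^+ k * (t == ((m + k)%N, (n - k - 1)%N))%:R
  + mu1 * (1 - gamma) ^+ n * ((0 < n)%N && (t == ((m + n)%N, 0%N)))%:R.

Definition N_weight (R : realType) (lambda1 lambda2 mu1 mu2 theta : R)
    (m n : nat) : R :=
  if (1 <= m)%N then
    mu1 / (mu1 + mu2 + m%:R * theta)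
    * (\prod_(1 <= i < m.+1) (lambda2 / (mu2 + i%:R * theta)))
    * (\prod_(1 <= i < n.+1)
         ((lambda1 + lambda2) / (mu1 + mu2 + m%:R * theta + i%:R * theta)))
  else
    \prod_(1 <= i < n.+1) ((lambda1 + lambda2) / (mu1 + mu2 + i%:R * theta)).

(* Main.v *)
(* Let p = 1 - gamma_s. The inflow into (m, n) caused by type 1 demand scanning
   the unknown part is a sum over the antidiagonal m + n + 1. For the claimed
   weights w it telescopes:
     sum_(k <= m) w(m - k, n + k) p^k = w(m, n) (mu1 + mu2 + m theta_s) / mu1
   for m >= 1, and the balance equations become rational identities.
   The weights decay like x^m / m! * y^n / n!, so both the weights and their
   products with the total outgoing rates are summable.
   The chain has unbounded rates, so uniqueness needs an argument: the minimum
   of a second solution and a multiple of the first one is subinvariant with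
   finite total flow, hence balanced, and irreducibility gives proportionality. *)

Require Import Defs.
From mathcomp Require Import all_boot all_order all_algebra.
From mathcomp Require Import all_classical all_reals all_analysis.
From mathcomp Require Import ring lra zify.
Import Order.TTheory GRing.Theory Num.Theory.
Local Open Scope classical_set_scope.
Local Open Scope ring_scope.

Set Implicit Arguments.
Unset Strict Implicit.

(** * Sums of nonnegative families in the extended reals *)

Lemma esumZl (R : realType) (T : choiceType) (c : R) (f : T -> \bar R) :
  0 <= c -> (forall t, 0 <= f t)%E ->
  (\esum_(t in [set: T]) (c%:E * f t) = c%:E * \esum_(t in [set: T]) f t)%E.
Proof.
move=> c0 f0.
(* For [c > 0], the reverse inequality is this same bound applied to the scalar [c^-1] and the
   family [c * f]. *)
have esumZl_le (d : R) (g : T -> \bar R) : 0 <= d -> (forall t, 0 <= g t)%E ->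
    (\esum_(t in [set: T]) (d%:E * g t) <= d%:E * \esum_(t in [set: T]) g t)%E.
  move=> d0 g0; apply: ge_ereal_sup => _ [X [finX _] <-].
  rewrite -ge0_mule_fsumr//; apply: lee_pmul => //.
  - exact: fsume_ge0.
  - by apply: ereal_sup_ubound; exists X.
apply/eqP; rewrite eq_le esumZl_le//=.
have [->|cn0] := eqVneq c 0; first by rewrite mul0e esum_ge0// => t _; rewrite mul0e.
have cgt0 : 0 < c by rewrite lt_def cn0.
rewrite -lee_pdivlMl//.
have {1}-> : f = (fun t => (c^-1%:E * (c%:E * f t)))%E.
  by apply/funext => t; rewrite muleA -EFinM mulVf// mul1e.
by apply: esumZl_le => [|t]; rewrite ?invr_ge0// mule_ge0// lee_fin.
Qed.

Lemma esum_pair (R : realType) (S T : choiceType) (a : S -> T -> \bar R) :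
  (forall s t, 0 <= a s t)%E ->
  (\esum_(x in [set: S * T]) a x.1 x.2
   = \esum_(s in [set: S]) \esum_(t in [set: T]) a s t)%E.
Proof.
move=> a0; rewrite esum_esum//.
by rewrite (_ : _ `*`` _ = setT)//; apply/seteqP; split.
Qed.

Lemma exchange_esum (R : realType) (S T : choiceType) (a : S -> T -> \bar R) :
  (forall s t, 0 <= a s t)%E ->
  (\esum_(s in [set: S]) \esum_(t in [set: T]) a s t
   = \esum_(t in [set: T]) \esum_(s in [set: S]) a s t)%E.
Proof.
move=> a0; rewrite -esum_pair// -esum_pair//.
rewrite (reindex_esum setT _ (fun x : T * S => (x.2, x.1)))//.
split => [[i j]|[i1 i2] [j1 j2] _ _ [-> ->]|[i j]] //=.
by exists (j, i).
Qed.

(** The finite sums cancel, so the nonnegative differences [a s - b s] have sum zero, and each of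
    them is at most that sum. *)
Lemma esum_eq_of_le (R : realType) (S : choiceType) (a b : S -> R) :
  (forall s, 0 <= b s) -> (forall s, b s <= a s) ->
  (\esum_(s in [set: S]) (a s)%:E = \esum_(s in [set: S]) (b s)%:E)%E ->
  (\esum_(s in [set: S]) (a s)%:E < +oo)%E -> a = b.
Proof.
move=> b0 ba eab afin; apply/funext => s.
have b_fin : (\esum_(s in [set: S]) (b s)%:E \is a fin_num)%E.
  by rewrite ge0_fin_numE ?esum_ge0// -?eab// => t _; rewrite lee_fin.
have d0 t : (0 <= (a t - b t)%:E)%E by rewrite lee_fin subr_ge0.
have sumd : (\esum_(s in [set: S]) (a s - b s)%:E = 0)%E.
  have : (\esum_(s in [set: S]) (a s)%:E =
     \esum_(s in [set: S]) (b s)%:E + \esum_(s in [set: S]) (a s - b s)%:E)%E.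
    rewrite -esumD//; first by apply: eq_esum => t _; rewrite -EFinD addrC subrK.
    by move=> t _; rewrite lee_fin.
  move: b_fin; rewrite eab; case: (esum _ _) => // r _.
  by case: (esum _ _) => // d [/eqP]; rewrite -[X in X == _]addr0 (inj_eq (addrI r)) => /eqP <-.
have : ((a s - b s)%:E <= 0)%E.
  rewrite -sumd (esumID [set s])// setI1 mem_set// esum_set1//.
  by rewrite leeDl// esum_ge0.
by rewrite lee_fin subr_le0 => ab; apply/eqP; rewrite eq_le ab ba.
Qed.

(** * Chains with finitely many transitions into and out of each state *)

Definition point_masses (R : realType) (S : choiceType) (l : seq (S * R))
    (t : S) : R :=
  \sum_(x <- l) x.2 * (t == x.1)%:R.

(** This turns the sums over all states in the balance equations into finite sums over transition
    lists. *)
Lemma esum_point_masses (R : realType) (S : choiceType) (f : S -> R)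
    (l : seq (S * R)) :
  (forall s, 0 <= f s) -> all (fun x => 0 <= x.2) l ->
  (\esum_(t in [set: S]) (f t * point_masses l t)%:E =
   (\sum_(x <- l) f x.1 * x.2)%:E)%E.
Proof.
move=> f0; elim: l => [_|x l ih /= /andP[x0 l0]].
  by rewrite big_nil esum1// => t _; rewrite /point_masses big_nil mulr0.
rewrite big_cons EFinD -ih//.
have pm0 t : 0 <= point_masses l t.
  rewrite /point_masses big_seq sumr_ge0// => y yl.
  by rewrite mulr_ge0 ?ler0n//; exact: (allP l0).
have -> : ((f x.1 * x.2)%:E = \esum_(t in [set: S]) (f t * (x.2 * (t == x.1)%:R))%:E)%E.
  rewrite (esumID [set x.1])/=; last by move=> t _; rewrite lee_fin !mulr_ge0.
  rewrite setTI esum_set1 ?eqxx ?mulr1 ?lee_fin ?mulr_ge0//.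
  rewrite esum1 ?adde0// => t [_ /= /eqP/negbTE->].
  by rewrite !mulr0.
rewrite -esumD; last 2 first.
  by move=> t _; rewrite lee_fin !mulr_ge0.
  by move=> t _; rewrite lee_fin mulr_ge0.
by apply: eq_esum => t _; rewrite -EFinD -mulrDr /point_masses big_cons.
Qed.

(* [out s] lists the transitions from s as (target, rate) and [inn s] lists the
   transitions into s as (source, rate); repetitions add up. *)
Definition locally_finite (R : realType) (S : choiceType) (q : S -> S -> R)
    (out inn : S -> seq (S * R)) : Prop :=
  [/\ forall s, all (fun x => 0 <= x.2) (out s),
      forall s, all (fun x => 0 <= x.2) (inn s),
      forall s t, q s t = point_masses (out s) t &
      forall s t, q s t = point_masses (inn t) s].

Definition total_rate (R : realType) (S : choiceType)
    (out : S -> seq (S * R)) (s : S) : R :=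
  \sum_(x <- out s) x.2.

Definition inflow (R : realType) (S : choiceType)
    (inn : S -> seq (S * R)) (f : S -> R) (s : S) : R :=
  \sum_(x <- inn s) f x.1 * x.2.

Section locally_finite_chains.
Context {R : realType} {S : choiceType} {q : S -> S -> R}.
Context {out inn : S -> seq (S * R)}.
Implicit Types f : S -> R.

Lemma locally_finite_ge0 : locally_finite q out inn -> forall s t, 0 <= q s t.
Proof.
case=> out0 _ qE _ s t; rewrite qE /point_masses big_seq sumr_ge0// => x xs.
by rewrite mulr_ge0 ?ler0n//; exact: (allP (out0 s)).
Qed.

Lemma esum_outflow : locally_finite q out inn -> forall f s, (forall t, 0 <= f t) ->
  (\esum_(t in [set: S]) (f s * q s t)%:E = (f s * total_rate out s)%:E)%E.
Proof.
case=> out0 _ qE _ f s f0.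
under eq_esum do rewrite qE.
by rewrite (esum_point_masses (f := fun=> f s))// -mulr_sumr.
Qed.

Lemma esum_inflow : locally_finite q out inn -> forall f s, (forall t, 0 <= f t) ->
  (\esum_(t in [set: S]) (f t * q t s)%:E = (inflow inn f s)%:E)%E.
Proof.
case=> _ inn0 _ qE f s f0.
under eq_esum do rewrite qE.
by rewrite esum_point_masses.
Qed.

Lemma steady_stateP : locally_finite q out inn -> forall f,
  steady_state q f <->
  [/\ forall s, 0 <= f s, (\esum_(s in [set: S]) (f s)%:E = 1)%E &
      forall s, f s * total_rate out s = inflow inn f s].
Proof.
move=> lf f; split=> -[f0 f1 fb]; split=> // s.
  by apply: EFin_inj; rewrite -(esum_outflow lf)// -(esum_inflow lf).
by rewrite (esum_outflow lf)// (esum_inflow lf)// fb.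
Qed.

Lemma inflow_le : locally_finite q out inn -> forall f g s,
  (forall t, f t <= g t) -> inflow inn f s <= inflow inn g s.
Proof.
case=> _ inn0 _ _ f g s fg; rewrite /inflow big_seq [leRHS]big_seq.
by apply: ler_sum => x xs; rewrite ler_wpM2r//; exact: (allP (inn0 s)).
Qed.

(* Summing the inequality over s, both sides become the finite total flow
   [\sum_s f s * total_rate s]. *)
Lemma subinvariant_balanced : locally_finite q out inn -> forall f,
  (forall s, 0 <= f s) ->
  (\esum_(s in [set: S]) (f s * total_rate out s)%:E < +oo)%E ->
  (forall s, inflow inn f s <= f s * total_rate out s) ->
  forall s, f s * total_rate out s = inflow inn f s.
Proof.
move=> lf f f0 ffin fsub s.
have := @esum_eq_of_le _ _ (fun s => f s * total_rate out s) (inflow inn f).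
move=> /(_ _ fsub _ ffin) fE; rewrite -[LHS]/((fun s => _) s) fE//.
- move=> t; case: lf => _ inn0 _ _; rewrite /inflow big_seq sumr_ge0// => x xt.
  by rewrite mulr_ge0//; exact: (allP (inn0 t)).
- under eq_esum do rewrite -(esum_outflow lf)//.
  rewrite exchange_esum; last first.
    by move=> t u; rewrite lee_fin mulr_ge0// (locally_finite_ge0 lf).
  by apply: eq_esum => t _; rewrite esum_inflow.
Qed.

(** A vanishing inflow has only vanishing terms, so the zero set of a balanced [f] is closed under
    predecessors. Irreducibility is taken in the form that a nonempty set with this closure contains
    every state. *)
Lemma balanced_eq0 : locally_finite q out inn ->
  (forall Z : S -> Prop, (exists s, Z s) ->
     (forall s t, Z t -> 0 < q s t -> Z s) -> forall s, Z s) ->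
  forall f, (forall s, 0 <= f s) ->
  (forall s, f s * total_rate out s = inflow inn f s) ->
  forall s0, f s0 = 0 -> forall s, f s = 0.
Proof.
move=> lf irr f f0 fb s0 fs0; apply: irr; first by exists s0.
move=> s t ft q_gt0.
have : (\esum_(u in [set: S]) (f u * q u t)%:E = 0)%E.
  by rewrite (esum_inflow lf)// -fb ft mul0r.
have fq0 u : (0 <= (f u * q u t)%:E)%E.
  by rewrite lee_fin mulr_ge0// (locally_finite_ge0 lf).
rewrite (esumID [set s])// setTI esum_set1// => /eqP.
rewrite padde_eq0 ?esum_ge0// => /andP[/eqP[/eqP]].
by rewrite mulf_eq0 (gt_eqF q_gt0) orbF => /eqP.
Qed.

(* The chain may have unbounded rates, and nothing is assumed on the total flow
   of the second solution pi'. Truncating it to min(pi', c pi) makes the flow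
   finite; the truncation is subinvariant, hence balanced. Choosing c so that
   c pi and pi' agree at s0, the balanced function c pi - min(pi', c pi) vanishes
   at s0, hence everywhere. *)
Lemma steady_state_unique : locally_finite q out inn ->
  (forall Z : S -> Prop, (exists s, Z s) ->
     (forall s t, Z t -> 0 < q s t -> Z s) -> forall s, Z s) ->
  forall f g, (forall s, 0 < f s) -> steady_state q f ->
  (\esum_(s in [set: S]) (f s * total_rate out s)%:E < +oo)%E ->
  steady_state q g -> g = f.
Proof.
move=> lf irr f g f_gt0 /(steady_stateP lf)[f0 f1 fb] ffin.
move=> /(steady_stateP lf)[g0 g1 gb].
have r0 s : 0 <= total_rate out s.
  case: lf => out0 _ _ _; rewrite /total_rate big_seq sumr_ge0// => x.
  exact: (allP (out0 s)).
(* Both functions have total mass 1, so pointwise domination forces equality. *)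
suff gf s0 : g s0 <= f s0.
  by apply/esym/esum_eq_of_le; rewrite ?f1 ?g1 ?ltry.
pose c := g s0 / f s0.
have c0 : 0 <= c by rewrite divr_ge0.
pose h s := Num.min (g s) (c * f s).
have h0 s : 0 <= h s by rewrite le_min g0 mulr_ge0.
have cfb s : c * f s * total_rate out s = inflow inn (fun s => c * f s) s.
  rewrite -mulrA fb /inflow mulr_sumr.
  by apply: eq_bigr => x _; rewrite mulrA.
have hb : forall s, h s * total_rate out s = inflow inn h s.
  apply: subinvariant_balanced => // [|s].
    apply: (@le_lt_trans _ _ (c%:E * \esum_(s in [set: S]) (f s * total_rate out s)%:E)%E).
      rewrite -esumZl//; last by move=> t; rewrite lee_fin mulr_ge0.
      apply: le_esum => s _; rewrite -EFinM lee_fin mulrA ler_wpM2r//.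
      by rewrite ge_min lexx orbT.
    by rewrite lte_mul_pinfty// lee_fin.
  (* Whichever of [g] and [c * f] attains the minimum at [s] is balanced there, and its inflow
     dominates that of [h]. *)
  rewrite /h; case: (leP (g s) (c * f s)) => _.
    rewrite gb; apply: (inflow_le lf) => t; by rewrite ge_min lexx.
  rewrite cfb; apply: (inflow_le lf) => t; by rewrite ge_min lexx orbT.
have dE : forall s, c * f s - h s = 0.
  apply: (balanced_eq0 lf irr) (s0) _ => [s|s|].
  - by rewrite subr_ge0 ge_min lexx orbT.
  - rewrite mulrBl cfb hb /inflow -sumrB.
    by apply: eq_bigr => x _; rewrite mulrBl.
  - by rewrite /h /c divfK ?gt_eqF// minxx subrr.
have cfg s : c * f s <= g s.
  by move: (dE s) => /eqP; rewrite subr_eq0 => /eqP->; rewrite ge_min lexx.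
(* Both total masses are 1, so summing [c * f <= g] gives [c <= 1]. *)
have : (c%:E * (\esum_(s in [set: S]) (f s)%:E) <= \esum_(s in [set: S]) (g s)%:E)%E.
  rewrite -esumZl//.
  by apply: le_esum => s _; rewrite -EFinM lee_fin.
by rewrite f1 g1 mule1 lee_fin ler_pdivrMr// mul1r.
Qed.

End locally_finite_chains.

(** * The N-system: lists of outgoing and incoming transitions *)

Section N_system.
Context {R : realType} {lambda1 lambda2 mu1 mu2 theta : R}.
Local Notation L := (lambda1 + lambda2).
Local Notation mu := (mu1 + mu2).
Local Notation gamma := (flexible_prob lambda1 lambda2).
Local Notation rate := (N_rate lambda1 lambda2 mu1 mu2 theta).
Local Notation weight := (N_weight lambda1 lambda2 mu1 mu2 theta).

(** Transitions missing at the boundary stay in the list with rate zero through the indicator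
    factors, so a truncated predecessor such as [0.-1] is harmless. *)
Definition N_out (s : nat * nat) : seq ((nat * nat) * R) :=
  let: (m, n) := s in
  [:: ((m, n.+1), L);
      ((m.-1, n), (mu2 + m%:R * theta) * (0 < m)%N%:R);
      ((0%N, n.-1), mu2 * ((m == 0%N) && (0 < n)%N)%:R);
      ((m, n.-1), n%:R * theta * (0 < n)%N%:R);
      ((m + n, 0)%N, mu1 * (1 - gamma) ^+ n * (0 < n)%N%:R)]
  ++ [seq ((m + k, n - k - 1)%N, mu1 * gamma * (1 - gamma) ^+ k)
     | k <- index_iota 0 n].

(** The last two families invert the scans: a successful one passing [k] units starts at
    [(m - k, n + k + 1)]; a failed one over [j >= 1] units starts at [(m - j, j)] and can only end
    with [n = 0]. *)
Definition N_inn (t : nat * nat) : seq ((nat * nat) * R) :=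
  let: (m, n) := t in
  [:: ((m, n.-1), L * (0 < n)%N%:R);
      ((m.+1, n), mu2 + m.+1%:R * theta);
      ((0%N, n.+1), mu2 * (m == 0%N)%:R);
      ((m, n.+1), n.+1%:R * theta)]
  ++ [seq ((m - k, n + k.+1)%N, mu1 * gamma * (1 - gamma) ^+ k)
     | k <- index_iota 0 m.+1]
  ++ [seq ((m - j, j)%N, mu1 * (1 - gamma) ^+ j * (n == 0%N)%:R)
     | j <- index_iota 1 m.+1].

Lemma N_rate_out s t : rate s t = point_masses (N_out s) t.
Proof.
case: s => m n; rewrite /N_rate /point_masses /N_out big_cat/= !big_cons big_map big_nil.
move: (flexible_prob _ _) => g; cbn [fst snd].
rewrite addr0.
rewrite -!mulrA -!natrM !mulnb -!andbA.
under [in RHS]eq_bigr do rewrite -mulrA.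
under [in LHS]eq_bigr do rewrite -mulrA.
by rewrite -!addrA; do 4!congr (_ + _); rewrite addrC.
Qed.

Lemma N_rate_inn s t : rate s t = point_masses (N_inn t) s.
Proof.
case: s t => m' n' [m n].
rewrite /N_rate /point_masses /N_inn.
move IE: (index_iota 0 m.+1) => I; move JE: (index_iota 1 m.+1) => J.
rewrite !big_cat/= !big_cons !big_map big_nil.
move: (flexible_prob _ _) => g; cbn [fst snd].
rewrite -{}IE -{}JE addr0 -!mulrA -!natrM !mulnb -!addrA; congr (_ + _).
  by congr (_ * _%:R); rewrite !xpair_eqE; lia.
congr (_ + _).
  have [[-> ->]|ne] := eqVneq (m', n') (m.+1, n); first by rewrite eqxx.
  rewrite mulr0; case: m' ne => [|m'] ne; rewrite ?mulr0//=.
  rewrite (_ : _ == _ = false) ?mulr0//.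
  by apply/negbTE; move: ne; rewrite !xpair_eqE; lia.
congr (_ + _).
  by congr (_ * _%:R); rewrite !xpair_eqE; lia.
congr (_ + _).
  have [[-> ->]|ne] := eqVneq (m', n') (m, n.+1); first by rewrite eqxx.
  rewrite mulr0; case: n' ne => [|n'] ne; rewrite ?mulr0//=.
  rewrite (_ : _ == _ = false) ?mulr0//.
  by apply/negbTE; move: ne; rewrite !xpair_eqE; lia.
congr (_ + _).
  (* One sum is cut off at [n'], the other at [m.+1]. Over the common range [N] the cutoffs join the
     indicators, and the resulting conditions coincide. *)
  pose N := (n' + m.+1)%N.
  rewrite (big_nat_widen _ _ N)//; last by rewrite /N leq_addr.
  rewrite [RHS](big_nat_widen _ _ N)//; last by rewrite /N leq_addl.
  rewrite big_mkcond [RHS]big_mkcond; apply: eq_bigr => k _ /=.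
  have : ((m', n') == ((m - k)%N, (n + k.+1)%N)) && (k < m.+1)%N =
         ((m, n) == ((m' + k)%N, (n' - k - 1)%N)) && (k < n')%N.
    by rewrite !xpair_eqE; lia.
  case: (k < n')%N; case: (k < m.+1)%N; rewrite ?andbT ?andbF.
  - by move=> ->.
  - by move=> <-; rewrite mulr0.
  - by move=> ->; rewrite mulr0.
  - by [].
(* A failed scan from [(m', n')] passes exactly [n'] units, so only the index [j = n'] can
   contribute. *)
transitivity (\sum_(1 <= j < m.+1 | j == n')
    mu1 * ((1 - g) ^+ j * ((n == 0%N) && (m == m' + j)%N)%:R)).
  rewrite big_nat1_eq; case: ifP => cond; last first.
    rewrite (_ : _ && _ = false) ?mulr0//.
    by apply/negbTE; move: cond; rewrite !xpair_eqE; lia.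
  by congr (_ * (_ * _%:R)); move: cond; rewrite !xpair_eqE; lia.
rewrite big_mkcond; apply: eq_big_nat => j jm.
rewrite -!mulrA -natrM mulnb; case: eqVneq => [<-|ne].
  by congr (_ * (_ * _%:R)); move: jm; rewrite !xpair_eqE; lia.
rewrite (_ : _ && _ = false) ?mulr0//.
by apply/negbTE; move: ne; rewrite !xpair_eqE; lia.
Qed.

Context (hlambda1 : 0 < lambda1) (hlambda2 : 0 < lambda2).
Context (hmu1 : 0 < mu1) (hmu2 : 0 < mu2) (htheta : 0 < theta).

Let lambda1_ge0 : 0 <= lambda1 := ltW hlambda1.
Let lambda2_ge0 : 0 <= lambda2 := ltW hlambda2.
Let mu1_ge0 : 0 <= mu1 := ltW hmu1.
Let mu2_ge0 : 0 <= mu2 := ltW hmu2.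
Let theta_ge0 : 0 <= theta := ltW htheta.
Let L_gt0 : 0 < L := addr_gt0 hlambda1 hlambda2.
Let L_ge0 : 0 <= L := ltW L_gt0.
Let mu_gt0 : 0 < mu := addr_gt0 hmu1 hmu2.
Let mu_ge0 : 0 <= mu := ltW mu_gt0.

Let nat_theta_ge0 (k : nat) : 0 <= k%:R * theta.
Proof. by rewrite mulr_ge0. Qed.

Let den_gt0 (a : R) (k : nat) : 0 < a -> 0 < a + k%:R * theta.
Proof. by move=> a0; rewrite ltr_pwDl. Qed.

Let den_neq0 (a : R) (k : nat) : 0 < a -> a + k%:R * theta != 0.
Proof. by move=> a0; rewrite gt_eqF// den_gt0. Qed.

Lemma flexible_probC : 1 - gamma = lambda2 / L.
Proof. by rewrite /flexible_prob; field; rewrite gt_eqF. Qed.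

Lemma N_locally_finite : locally_finite rate N_out N_inn.
Proof.
have g0 : 0 <= gamma by rewrite /flexible_prob divr_ge0.
have p0 : 0 <= 1 - gamma by rewrite flexible_probC divr_ge0.
split; [case=> m n|case=> m n|exact: N_rate_out|exact: N_rate_inn].
  rewrite /N_out; move: (flexible_prob _ _) (1 - _) g0 p0 => g p g0 p0.
  rewrite all_cat all_map /= !(mulr_ge0, addr_ge0, exprn_ge0)//=.
  by apply/allP => k _ /=; rewrite !(mulr_ge0, exprn_ge0).
rewrite /N_inn; cbv beta iota; move: (flexible_prob _ _) (1 - _) g0 p0 => g p g0 p0.
move: (index_iota 0 m.+1) (index_iota 1 m.+1) => I J.
rewrite !all_cat !all_map /= !(mulr_ge0, addr_ge0)//=.
by apply/andP; split; apply/allP => k _ /=; rewrite !(mulr_ge0, exprn_ge0).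
Qed.

(** * Total rates and balance equations for the weights *)

Lemma N_total_rate m n :
  total_rate N_out (m, n) =
  L + mu2 * ((0 < m) || (0 < n))%N%:R + m%:R * theta + n%:R * theta
  + mu1 * (0 < n)%N%:R.
Proof.
rewrite /total_rate /N_out big_cat/= !big_cons big_map big_nil/= addr0.
move: (flexible_prob _ _) => g.
(* Geometric sum for the successful scans; the failed ones contribute the missing
   [mu1 * (1 - g) ^+ n] when [n > 0]. *)
have -> : \sum_(0 <= k < n) mu1 * g * (1 - g) ^+ k = mu1 * (1 - (1 - g) ^+ n).
  rewrite -mulr_sumr -mulrA big_mkord.
  have := subrXX 1 (1 - g) n; rewrite expr1n subKr => ->.
  by congr (_ * (_ * _)); apply: eq_bigr => i _; rewrite expr1n mul1r.
by case: m n => [|m] [|n] /=; rewrite ?expr0 /=; ring.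
Qed.

(* With M_m, Q_m the products over 1 <= i <= m of mu2 + i theta and
   mu1 + mu2 + i theta, this is lambda2^m L^n Q_m / (M_m Q_(m+n)). *)
Definition scan_weight (m n : nat) : R :=
  (\prod_(1 <= i < m.+1) (lambda2 / (mu2 + i%:R * theta)))
  * (\prod_(1 <= i < n.+1) (L / (mu + m%:R * theta + i%:R * theta))).

Lemma N_weight_scan m n :
  weight m n =
  (if (0 < m)%N then mu1 / (mu + m%:R * theta) else 1) * scan_weight m n.
Proof.
rewrite /N_weight /scan_weight; case: m => [|m] /=; rewrite ?mulrA//.
rewrite mul1r [X in _ = X * _]big_nil mul1r; apply: eq_bigr => i _.
by rewrite mul0r addr0.
Qed.

Lemma scan_weightSr m n :
  scan_weight m n.+1 = scan_weight m n * (L / (mu + (m + n.+1)%:R * theta)).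
Proof.
by rewrite /scan_weight [X in _ * X = _]big_nat_recr//= mulrA natrD
  [in RHS](mulrDl _ _ theta) addrA.
Qed.

(** Both states lie on one antidiagonal, and their denominators [mu + i * theta] differ only by
    [i = m + 1], which occurs at [(m, n + 1)] alone. *)
Lemma scan_weightSl m n :
  scan_weight m.+1 n = scan_weight m n.+1 *
    (lambda2 / (mu2 + m.+1%:R * theta) * (mu + m.+1%:R * theta) / L).
Proof.
have L0 : L != 0 by rewrite gt_eqF.
rewrite /scan_weight [X in X * _ = _]big_nat_recr//= [X in _ = _ * X * _]big_nat_recl//.
rewrite -[in LHS]mulrA -[in RHS]mulrA; congr (_ * _).
rewrite (_ : \prod_(1 <= i < n.+1) _ =
  \prod_(1 <= i < n.+1) (L / (mu + m%:R * theta + i.+1%:R * theta))); last first.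
  apply: eq_bigr => i _; congr (_ / _).
  by rewrite -!addrA -!mulrDl -!natrD addSnnS.
rewrite (_ : mu + _ + 1%:R * theta = mu + m.+1%:R * theta); last first.
  by rewrite -addrA -mulrDl -natrD addn1.
have := den_neq0 m.+1 mu_gt0; have := den_neq0 m.+1 hmu2.
move: (m.+1%:R * theta) => a mu2a mua.
by field; rewrite mu2a mua L0.
Qed.

(** Induction along the antidiagonal. In the step put [a = (m + 1) * theta]: the term [k = 0] is the
    fraction [mu1 / (mu + a)] of [scan_weight m.+1 n], and the other terms, [1 - gamma] times the
    sum for [(m, n + 1)], are the complementary fraction [(mu2 + a) / (mu + a)]. *)
Lemma sum_scan m n :
  \sum_(0 <= k < m.+1) weight (m - k) (n + k) * (1 - gamma) ^+ k =
  scan_weight m n.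
Proof.
have L0 : L != 0 by rewrite gt_eqF.
elim: m n => [|m ih] n.
  by rewrite big_nat1 addn0 expr0 mulr1 N_weight_scan mul1r.
rewrite big_nat_recl// subn0 addn0 expr0 mulr1 N_weight_scan/=.
rewrite (eq_bigr (fun k =>
  weight (m - k) (n.+1 + k) * (1 - gamma) ^+ k * (1 - gamma))); last first.
  by move=> k _; rewrite subSS addSnnS exprSr mulrA.
rewrite -mulr_suml ih flexible_probC scan_weightSl.
have := den_neq0 m.+1 mu_gt0; have := den_neq0 m.+1 hmu2.
move: (m.+1%:R * theta) => a mu2a mua.
by field; rewrite mu2a mua L0.
Qed.

Lemma N_weight_balanced m n :
  weight m n * total_rate N_out (m, n) =
  inflow N_inn (fun s => weight s.1 s.2) (m, n).
Proof.
rewrite N_total_rate /inflow /N_inn.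
move IE: (index_iota 0 m.+1) => I; move JE: (index_iota 1 m.+1) => J.
rewrite !big_cat/= !big_cons !big_map big_nil; cbn [fst snd].
rewrite -{}IE -{}JE addr0.
have -> : \sum_(0 <= k < m.+1)
    weight (m - k) (n + k.+1) * (mu1 * gamma * (1 - gamma) ^+ k) =
    mu1 * gamma * scan_weight m n.+1.
  rewrite -sum_scan mulr_sumr; apply: eq_bigr => k _.
  by rewrite addSnnS mulrCA.
(* Failed scans reach only [n = 0]; their sum is that of [sum_scan m 0] without its term [k = 0]. *)
have -> : \sum_(1 <= j < m.+1)
    weight (m - j) j * (mu1 * (1 - gamma) ^+ j * (n == 0%N)%:R) =
    mu1 * (scan_weight m 0 - weight m 0) * (n == 0%N)%:R.
  rewrite -[in RHS](sum_scan m 0) [in RHS]big_ltn// subn0 addn0 expr0 mulr1 addrAC subrr add0r.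
  rewrite mulr_sumr mulr_suml; apply: eq_bigr => j _.
  by rewrite add0n; ring.
(* [lra] ignores section hypotheses. *)
move: (hlambda1) (hlambda2) (hmu1) (hmu2) (htheta) => ? ? ? ? ?.
rewrite !N_weight_scan scan_weightSl /flexible_prob.
(* Every surviving term is now a rational multiple of one common [scan_weight]; the indicators at
   [m = 0] and [n = 0] require four cases. *)
case: n => [|n]; rewrite !scan_weightSr; case: m => [|m];
  rewrite /= ?addn1 -?natr1 ?natrD.
- by field; rewrite !gt_eqF//; lra.
- by have := nat_theta_ge0 m => ?; field; rewrite !gt_eqF//; lra.
- by have := nat_theta_ge0 n => ?; field; rewrite !gt_eqF//; lra.
- have := nat_theta_ge0 m; have := nat_theta_ge0 n => ? ?.
  by field; rewrite !gt_eqF//; lra.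
Qed.

(** * Positivity and summability of the weights *)

Lemma scan_weight_gt0 m n : 0 < scan_weight m n.
Proof.
by rewrite mulr_gt0//; apply: prodr_gt0 => i _; rewrite divr_gt0 ?den_gt0.
Qed.

Lemma N_weight_gt0 m n : 0 < weight m n.
Proof.
rewrite N_weight_scan mulr_gt0 ?scan_weight_gt0//.
by case: ifP => // _; rewrite divr_gt0 ?den_gt0.
Qed.

(** Dropping [a] from each denominator leaves [(x / theta) ^+ n / n!]. *)
Lemma prod_div_le_exp_coeff (x a : R) (n : nat) : 0 <= x -> 0 <= a ->
  \prod_(1 <= i < n.+1) (x / (a + i%:R * theta)) <= exp_coeff (x / theta) n.
Proof.
move=> x0 a0; elim: n => [|n ih].
  by rewrite big_nil /exp_coeff/= expr0 fact0 divr1.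
rewrite big_nat_recr//= (_ : exp_coeff _ n.+1 =
  exp_coeff (x / theta) n * (x / (n.+1%:R * theta))); last first.
  rewrite /exp_coeff/= exprSr factS natrM; field.
  by rewrite gt_eqF//= nat1r pnatr_eq0/= pnatr_eq0 -lt0n fact_gt0.
have nth : 0 < n.+1%:R * theta by rewrite mulr_gt0.
apply: ler_pM => //.
- by rewrite prodr_ge0// => i _; rewrite divr_ge0// addr_ge0.
- by rewrite divr_ge0// addr_ge0.
- by rewrite ler_wpM2l// lef_pV2 ?posrE ?ltr_wpDl// lerDr.
Qed.

Lemma N_weight_le_exp_coeff m n :
  weight m n <= exp_coeff (lambda2 / theta) m * exp_coeff (L / theta) n.
Proof.
rewrite N_weight_scan (@le_trans _ _ (scan_weight m n))//.
  rewrite ler_piMl//; first exact/ltW/scan_weight_gt0.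
  by case: ifP => // _; rewrite ler_pdivrMr ?den_gt0// mul1r -addrA lerDl addr_ge0.
apply: ler_pM.
- by rewrite prodr_ge0// => i _; rewrite divr_ge0// addr_ge0.
- by rewrite prodr_ge0// => i _; rewrite divr_ge0// !addr_ge0.
- exact: prod_div_le_exp_coeff.
- by apply: prod_div_le_exp_coeff => //; rewrite addr_ge0.
Qed.

Lemma esum_exp_coeff (c x : R) : 0 <= c -> 0 <= x ->
  (\esum_(n in [set: nat]) (c * exp_coeff x n)%:E = (c * expR x)%:E)%E.
Proof.
move=> c0 x0; under eq_esum do rewrite EFinM.
rewrite esumZl//; last by move=> n; rewrite lee_fin exp_coeff_ge0.
rewrite EFinM; congr (_ * _)%E.
rewrite -nneseries_esumT; last by move=> n; rewrite lee_fin exp_coeff_ge0.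
rewrite /expR -EFin_lim; last exact: is_cvg_series_exp_coeff.
by apply/congr_lim/funext => n /=; rewrite sumEFin.
Qed.

(* The total rate grows linearly in m + n, so it is absorbed by a factor
   2 ^ (m + n), that is, by doubling the arguments of the exponentials. *)
Lemma esum_N_weight_total_rate :
  (\esum_(s in [set: nat * nat])
     (weight s.1 s.2 * (1 + total_rate N_out s))%:E < +oo)%E.
Proof.
(* Since [1] and [m + n] are both at most [2 ^+ (m + n)], this [K] gives
   [1 + total_rate <= K * 2 ^+ (m + n)]. *)
pose K := 1 + L + mu + theta.
have K0 : 0 <= K by rewrite !addr_ge0.
pose x := 2 * (lambda2 / theta); pose y := 2 * (L / theta).
have x0 : 0 <= x by rewrite mulr_ge0// divr_ge0.
have y0 : 0 <= y by rewrite mulr_ge0// divr_ge0.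
pose dom m n := (K * exp_coeff x m * exp_coeff y n)%:E.
have Kx0 m : 0 <= K * exp_coeff x m.
  by apply: mulr_ge0 => //; exact: exp_coeff_ge0.
have dom0 m n : (0 <= dom m n)%E.
  by rewrite lee_fin; apply: mulr_ge0 => //; exact: exp_coeff_ge0.
apply: (@le_lt_trans _ _ (\esum_(s in [set: nat * nat]) dom s.1 s.2)%E); last first.
  rewrite esum_pair//.
  under eq_esum do rewrite esum_exp_coeff// mulrAC.
  by rewrite esum_exp_coeff ?ltry//; apply: mulr_ge0 => //; exact: expR_ge0.
apply: le_esum => -[m n] _ /=; rewrite lee_fin.
have exp2 (z : R) k : exp_coeff (2 * z) k = 2 ^+ k * exp_coeff z k.
  by rewrite /exp_coeff/= exprMn mulrA.
rewrite /x /y !exp2.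
have -> : K * (2 ^+ m * exp_coeff (lambda2 / theta) m) *
    (2 ^+ n * exp_coeff (L / theta) n) =
  exp_coeff (lambda2 / theta) m * exp_coeff (L / theta) n * (K * 2 ^+ (m + n)).
  by rewrite exprD; ring.
rewrite N_total_rate; apply: ler_pM.
- exact/ltW/N_weight_gt0.
- by rewrite !addr_ge0 ?mulr_ge0.
- exact: N_weight_le_exp_coeff.
have two1 : 1 <= 2 ^+ (m + n) :> R by rewrite exprn_ege1// ler1n.
have two2 : m%:R + n%:R <= 2 ^+ (m + n) :> R.
  by rewrite -natrD -natrX ler_nat ltnW// ltn_expl.
have b01 (b : bool) : (b%:R : R) <= 1 by case: b; rewrite ?ler01.
rewrite (@le_trans _ _ (1 + L + mu + theta * (m%:R + n%:R)))//.
  rewrite (_ : 1 + (_ + mu1 * _) = 1 + L + (mu2 * ((0 < m) || (0 < n))%N%:R +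
     mu1 * (0 < n)%N%:R) + theta * (m%:R + n%:R)); last by ring.
  by rewrite lerD2r lerD2l [mu]addrC lerD// ler_piMr.
rewrite /K mulrDl; apply: lerD; rewrite ?ler_wpM2l//.
by rewrite ler_peMr// !addr_ge0.
Qed.

(** Going backwards from [(a, b)]: arrivals lead to [(a, 0)], a failed scan to [(0, a)], and
    arrivals again to [(0, 0)]. From there, type 2 demand traversed backwards reaches every [(0, n)]
    and then every [(m, n)]. *)
Lemma N_irreducible (Z : nat * nat -> Prop) : (exists s, Z s) ->
  (forall s t, Z t -> 0 < rate s t -> Z s) -> forall s, Z s.
Proof.
move=> [[a b] Zab] Zpred.
have pred_out s t r : Z t -> 0 < r -> (t, r) \in N_out s -> Z s.
  move=> Zt r0 tr; apply: (Zpred s t Zt); rewrite N_rate_out /point_masses.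
  have [out0 _ _ _] := N_locally_finite.
  rewrite (big_rem _ tr) /= eqxx mulr1 ltr_pwDl// big_seq sumr_ge0// => x xs.
  by rewrite mulr_ge0// (allP (out0 s))// (mem_rem xs).
have {b Zab} Za0 : Z (a, 0%N).
  elim: b Zab => // b ih Zab; apply: ih; apply: (pred_out _ _ L Zab) => //.
  exact: mem_head.
have Z00 : Z (0%N, 0%N).
  have p0 : 0 < 1 - gamma by rewrite flexible_probC divr_gt0.
  have Z0a : Z (0%N, a).
    case: a Za0 => // a {}Za0.
    apply: (pred_out _ _ (mu1 * (1 - gamma) ^+ a.+1) Za0).
      by rewrite mulr_gt0// exprn_gt0.
    by rewrite /N_out mem_cat !inE; apply/orP; left; do 4!(apply/orP; right);
      rewrite mulr1.
  elim: a Z0a {Za0} => // a ih Z0a; apply: ih.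
  by apply: (pred_out _ _ L Z0a) => //; exact: mem_head.
case; elim=> [|m ih] n; last first.
  apply: (pred_out _ _ (mu2 + m.+1%:R * theta) (ih n)); first by rewrite den_gt0.
  by rewrite /N_out mem_cat !inE; apply/orP; left; apply/orP; right;
    rewrite mulr1 eqxx.
elim: n => // n ih; apply: (pred_out _ _ mu2 ih) => //.
by rewrite /N_out mem_cat !inE; apply/orP; left; do 2!(apply/orP; right);
  rewrite mulr1 eqxx.
Qed.

End N_system.

(** * Normalization of the weights and conclusion *)

Unset Implicit Arguments.
Set Strict Implicit.

Theorem theorem1 (R : realType) (lambda1 lambda2 mu1 mu2 theta : R)
    (hlambda1 : 0 < lambda1) (hlambda2 : 0 < lambda2)
    (hmu1 : 0 < mu1) (hmu2 : 0 < mu2) (htheta : 0 < theta) :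
  exists (pi : nat * nat -> R) (B : R),
    [/\ steady_state (N_rate lambda1 lambda2 mu1 mu2 theta) pi /\
        (forall pi' : nat * nat -> R,
           steady_state (N_rate lambda1 lambda2 mu1 mu2 theta) pi' ->
           forall s, pi' s = pi s),
        forall m n : nat,
          pi (m, n) = N_weight lambda1 lambda2 mu1 mu2 theta m n * B,
        B = pi (0%N, 0%N) &
        (\esum_(s in [set: nat * nat])
           (N_weight lambda1 lambda2 mu1 mu2 theta s.1 s.2 * B)%:E = 1)%E].
Proof.
pose w (s : nat * nat) := N_weight lambda1 lambda2 mu1 mu2 theta s.1 s.2.
pose r := total_rate (@N_out R lambda1 lambda2 mu1 mu2 theta).
have lf := N_locally_finite hlambda1 hlambda2 hmu1 hmu2 htheta.
have w_gt0 s : 0 < w s by exact: N_weight_gt0.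
have w_ge0 s : 0 <= w s by exact: ltW.
have wE_ge0 s : (0 <= (w s)%:E)%E by rewrite lee_fin.
have r_ge0 s : 0 <= r s.
  case: lf => out0 _ _ _; rewrite /r /total_rate big_seq sumr_ge0// => x.
  exact: (allP (out0 s)).
have wr_fin := esum_N_weight_total_rate hlambda1 hlambda2 hmu1 hmu2 htheta.
rewrite -/r in wr_fin.
(* Used with [f = 1] for the total mass and with [f = r] for the total flow. *)
have le_wr (f : nat * nat -> R) : (forall s, f s <= 1 + r s) ->
    (\esum_(s in [set: nat * nat]) (w s * f s)%:E < +oo)%E.
  move=> fr; apply: le_lt_trans wr_fin; apply: le_esum => s _.
  by rewrite lee_fin ler_wpM2l.
have w_fin : (\esum_(s in [set: nat * nat]) (w s)%:E \is a fin_num)%E.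
  rewrite ge0_fin_numE; last exact: esum_ge0.
  under eq_esum do rewrite -[w _]mulr1.
  by apply: le_wr => s; rewrite lerDl.
pose W := fine (\esum_(s in [set: nat * nat]) (w s)%:E)%E.
have WE : (\esum_(s in [set: nat * nat]) (w s)%:E = W%:E)%E by rewrite /W fineK.
have W_gt0 : 0 < W.
  rewrite -lte_fin -WE (@lt_le_trans _ _ (w (0, 0)%N)%:E) ?lte_fin//.
  rewrite (esumID [set (0, 0)%N])// setTI esum_set1//.
  by rewrite leeDl// esum_ge0.
have Winv_ge0 : 0 <= W^-1 by rewrite invr_ge0 ltW.
pose pi s := w s * W^-1.
have pi_gt0 s : 0 < pi s by rewrite mulr_gt0// invr_gt0.
have pi_sum : (\esum_(s in [set: nat * nat]) (pi s)%:E = 1)%E.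
  rewrite /pi; under eq_esum do rewrite mulrC EFinM.
  rewrite esumZl ?Winv_ge0//.
  by rewrite WE -EFinM mulVf// gt_eqF.
have pi_steady : steady_state (N_rate lambda1 lambda2 mu1 mu2 theta) pi.
  apply/(steady_stateP lf); split => // [s|[m n]]; first exact: ltW.
  have := N_weight_balanced hlambda1 hlambda2 hmu1 hmu2 htheta m n.
  rewrite /pi mulrAC => ->; rewrite /inflow mulr_suml.
  by apply: eq_bigr => x _; rewrite mulrAC.
exists pi, W^-1; split=> //.
- split=> // pi' pi'_steady s.
  have irr := N_irreducible hlambda1 hlambda2 hmu1 hmu2 htheta.
  rewrite (steady_state_unique lf irr pi_gt0 pi_steady _ pi'_steady)//.
  rewrite (eq_esum (b := fun s => (W^-1%:E * (w s * r s)%:E)%E)); last first.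
    by move=> t _; rewrite -EFinM /pi mulrAC mulrC.
  rewrite esumZl//; last by move=> t; rewrite lee_fin mulr_ge0.
  rewrite lte_mul_pinfty//.
  by apply: le_wr => t; rewrite lerDr.
(* The weight of [(0, 0)] is an empty product, so [pi (0, 0)] equals [W^-1]. *)
- by rewrite /pi /w /N_weight /= big_nil mul1r.
Qed.
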